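(* Consider the two-way unsplittable trading problem with known price range $[m,M]$, $0<m<M$, fluctuation ratio $\varphi=M/m$, and at most $k\ge 1$ trades. For every $\epsilon>0$, no deterministic online algorithm has competitive ratio smaller than $\varphi^{(2k+1)/3-\epsilon}$.
   Context: Two-way unsplittable trading problem: a sequence of prices $p(1),\ldots,p(T)$ (positive reals), one per day, is revealed online; the horizon length $T$ is not known to the online algorithm in advance, but when day $i$ arrives the algorithm learns whether $i=T$. The investor starts with cash and may make at most $k$ trades. A trade is a pair of days $(b,s)$ with $b<s$: on day $b$ all available money is used to buy the stock at price $p(b)$, and on day $s$ all stock is sold at price $p(s)$. Trades cannot overlap (a sale must happen before the next purchase), there is no short selling, no buying on the last day $T$, and any stock held on day $T$ is sold at price $p(T)$. The gain of a trade $(b,s)$ is $p(s)/p(b)$; the return is the product of the gains of the trades made ($1$ if none). OPT is the optimal offline algorithm making at most $k$ trades. The competitive ratio of an online algorithm is the supremum over admissible price sequences of (return of OPT)/(return of the algorithm). In this model all prices lie in $[m,M]$, and $m$ and $M$ are known to the online algorithm in advance. *)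

(* Defs.v *)
From HB Require Import structures.
From mathcomp Require Import all_boot all_order all_algebra.
From mathcomp Require Import all_classical all_reals all_analysis.

Set Implicit Arguments.
Unset Strict Implicit.
Unset Printing Implicit Defensive.

Import Order.TTheory GRing.Theory Num.Theory.

Local Open Scope classical_set_scope.
Local Open Scope ring_scope.

(** A price sequence is a [seq R]; its length is the horizon [T], and days are
    numbered [0, ..., T - 1], so the last day is [T - 1]. *)

Definition admissible (R : realType) (m M : R) : set (seq R) :=
  [set p | (0 < size p)%N /\ forall x, x \in p -> m <= x <= M].

(** A trade [(b, s)]: buy on day [b], sell on day [s]. *)
Definition trade : Type := (nat * nat)%type.

(** [b < s < T] already rules out a purchase on the last day. *)
Definition feasible (k T : nat) (l : seq trade) : bool :=
  [&& (size l <= k)%N,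
      all (fun t : trade => (t.1 < t.2 < T)%N) l &
      sorted (fun t u : trade => (t.2 < u.1)%N) l].

Definition gain (R : realType) (p : seq R) (t : trade) : R :=
  nth 0 p t.2 / nth 0 p t.1.

Definition total_return (R : realType) (p : seq R) (l : seq trade) : R :=
  \prod_(t <- l) gain p t.

(** The supremum is a maximum: there are finitely many feasible [l]. *)
Definition OPT (R : realType) (k : nat) (p : seq R) : R :=
  sup [set total_return p l | l in [set l | feasible k (size p) l]].

Variant action := Buy | Sell | Hold.

Definition is_buy (a : action) : bool := if a is Buy then true else false.
Definition is_sell (a : action) : bool := if a is Sell then true else false.

(** The decision on a day is a function of the prices revealed so far (today's
    included) and of whether today is the last day. The algorithm's own past
    actions are determined by the same data. *)
Definition online_algorithm (R : realType) : Type := seq R -> bool -> action.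

(** State: the day on which the stock currently held was bought, if any, and
    the completed trades. Requests that the rules forbid (buying while holding
    stock, on the last day, or after [k] trades; selling without stock) have no
    effect; stock held on the last day is sold whatever the algorithm says. *)
Definition day_step (R : realType) (k : nat) (A : online_algorithm R)
    (p : seq R) (st : option nat * seq trade) (d : nat) :
    option nat * seq trade :=
  let last_day := d.+1 == size p in
  let a := A (take d.+1 p) last_day in
  match st with
  | (Some b, l) =>
      if last_day || is_sell a then (None, rcons l (b, d)) else (Some b, l)
  | (None, l) =>
      if [&& ~~ last_day, (size l < k)%N & is_buy a]
      then (Some d, l) else (None, l)
  end.

Definition trades_of (R : realType) (k : nat) (A : online_algorithm R)
    (p : seq R) : seq trade :=
  (foldl (day_step k A p) (None, [::]) (iota 0 (size p))).2.

Definition competitive_ratio (R : realType) (m M : R) (k : nat)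
    (A : online_algorithm R) : \bar R :=
  ereal_sup [set (OPT k p / total_return p (trades_of k A p))%:E
            | p in admissible m M].

(* Main.v *)
Require Import Defs.
From HB Require Import structures.
From mathcomp Require Import all_boot all_order all_algebra.
From mathcomp Require Import all_classical all_reals all_analysis.
From mathcomp Require Import zify lra.

Set Implicit Arguments.
Unset Strict Implicit.
Unset Printing Implicit Defensive.

Import Order.TTheory GRing.Theory Num.Theory.
Local Open Scope ring_scope.

(** The adversary plays prices on a logarithmic grid [m * g ^+ e] with
    [M = m * g ^+ (3 * n)]; let [b = 2 * n - 1], i.e. [g ^+ b] is almost
    [phi `^ (2 / 3)]. Each trade of the offline player is made to win a factor
    [g ^+ b], and the last one almost [phi].

    - [restart i]: the offline player has used [i] trades and is ahead by
      [g ^+ (b * i)]. The adversary alternates a slowly decreasing price with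
      [M]. If the online player lets the price come down to about
      [m * phi `^ (1 / 3)], then the offline player has won a factor [g ^+ b]
      with one trade. If the online player buys, the adversary considers the
      stock as worth [m] from now on; the online player is [trapped i].
    - [trapped i]: the online player holds stock and, valuing it at [m], the
      offline player is ahead by about [phi `^ (1 / 3)] more than required with
      [i] trades, and also with [i + 1] trades. The adversary shows [m] and then
      [m * g ^+ b]. If the online player keeps the stock, the offline player
      trades on this rise, and the online player is [trapped (i + 1)]. If it
      sells, the price goes on to [M], which is a [restart (i + 1)].

    For the last trade, the decreasing price goes down to almost [m], and a
    final price [m] ends the game. *)

(** * Offline returns along growing price sequences *)

Section TotalReturn.
Variable R : realType.
Implicit Types (p q : seq R) (l : seq trade).

Lemma total_return_cat p q l :
  all (fun t : trade => (t.1 < size p)%N && (t.2 < size p)%N) l ->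
  total_return (p ++ q) l = total_return p l.
Proof.
move=> /allP h; rewrite /total_return; apply: eq_big_seq => t /h /andP[h1 h2].
by rewrite /gain !nth_cat h1 h2.
Qed.

Lemma total_return_rcons p l t :
  total_return p (rcons l t) = total_return p l * gain p t.
Proof. by rewrite /total_return -cats1 big_cat big_seq1. Qed.

Lemma feasible_in_range i p l : feasible i (size p) l ->
  all (fun t : trade => (t.1 < size p)%N && (t.2 < size p)%N) l.
Proof.
move=> /and3P[_ + _]; apply: sub_all => t /andP[h1 h2].
by rewrite h2 (ltn_trans h1 h2).
Qed.

(** A witness of trades instead of a bound on [OPT]: it survives any extension of the prices, and
    the supremum enters only at the very end. *)
Definition reach p i (v : R) :=
  exists2 l, feasible i (size p) l & v <= total_return p l.

Lemma reach_le p i v v' : v' <= v -> reach p i v -> reach p i v'.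
Proof. by move=> h [l fl /(le_trans h)]; exists l. Qed.

Lemma reach_cat p q i v : reach p i v -> reach (p ++ q) i v.
Proof.
move=> [l fl vl]; exists l; last first.
  by rewrite total_return_cat // (@feasible_in_range i).
move: fl => /and3P[sl al ol]; apply/and3P; split=> //.
by apply: sub_all al => t; rewrite size_cat; lia.
Qed.

Lemma reach_rcons p x i v : reach p i v -> reach (rcons p x) i v.
Proof. by rewrite -cats1; exact: reach_cat. Qed.

Lemma reachS p i v : reach p i v -> reach p i.+1 v.
Proof.
move=> [l /and3P[sl al ol] vl]; exists l => //; apply/and3P; split=> //.
exact: leqW.
Qed.

(** The new trade begins after all of [p], hence after the old trades; [q] holds the prices it
    skips. *)
Lemma reach_trade p q i v x y : 0 < x -> 0 < y ->
  reach p i v -> reach (p ++ x :: rcons q y) i.+1 (v * (y / x)).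
Proof.
move=> x0 y0 [l fl vl].
exists (rcons l (size p, size p + (size q).+1)%N).
  move: (fl) => /and3P[sl al ol]; apply/and3P; split.
  - by rewrite size_rcons.
  - rewrite all_rcons size_cat /= size_rcons; apply/andP; split; first by lia.
    by apply: sub_all al => t; lia.
  - case: l al ol {fl vl sl} => //= t l al ol.
    rewrite rcons_path ol /=.
    have /allP/(_ _ (mem_last t l))/andP[] :
      all (fun t : trade => (t.1 < t.2 < size p)%N) (t :: l) by [].
    by [].
rewrite total_return_rcons total_return_cat ?(@feasible_in_range i) //.
rewrite /gain /= !nth_cat ltnn subnn /= ltnNge leq_addr /= addKn /=.
rewrite nth_rcons ltnn eqxx ler_pM2r // divr_gt0 //.
Qed.

(** Crude bound, wanted only to make the set under the supremum in [OPT] bounded. *)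
Lemma total_return_le_expr i p l (c : R) : 1 <= c ->
  (forall x y, x \in p -> y \in p -> 0 <= y / x <= c) ->
  feasible i (size p) l -> total_return p l <= c ^+ i.
Proof.
move=> c1 hp fl; have hl := feasible_in_range fl.
case/and3P: fl => sl _ _.
apply: (@le_trans _ _ (c ^+ size l)); last by rewrite ler_weXn2l.
have : 0 <= total_return p l <= c ^+ size l; last by case/andP.
elim: l {sl} hl => [|t l IH] /=.
  by rewrite /total_return big_nil expr0 ler01 lexx.
case/andP => /andP[t1 t2] /IH /andP[h0 h1].
have /andP[g0 g1] := hp _ _ (mem_nth 0 t1) (mem_nth 0 t2).
rewrite /total_return big_cons -/(total_return p l) exprS.
by apply/andP; split; [exact: mulr_ge0 | exact: ler_pM].
Qed.

Lemma reach_le_OPT k p v (c : R) : 1 <= c ->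
  (forall x y, x \in p -> y \in p -> 0 <= y / x <= c) ->
  reach p k v -> v <= OPT k p.
Proof.
move=> c1 hp [l fl vl]; apply: (le_trans vl).
apply: ub_le_sup; last by exists l.
exists (c ^+ k) => _ [l' fl' <-]; exact: total_return_le_expr fl'.
Qed.

End TotalReturn.

(** * The online player before the horizon is announced *)

Section OnlineRun.
Variables (R : realType) (k : nat) (A : online_algorithm R).
Implicit Types (p : seq R) (x y : R).

(** This is [day_step] with the last-day flag off, so the state does not depend on prices still to
    come. *)
Definition running_step p (st : option nat * seq trade) (d : nat) :
    option nat * seq trade :=
  let a := A (take d.+1 p) false in
  match st with
  | (Some b, l) => if is_sell a then (None, rcons l (b, d)) else (Some b, l)
  | (None, l) => if (size l < k)%N && is_buy a then (Some d, l) else (None, l)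
  end.

(* The run of [A] on [p] when no day of [p] is announced as the last one. *)
Definition running_state p : option nat * seq trade :=
  foldl (running_step p) (None, [::]) (iota 0 (size p)).

Definition holding p : bool := isSome (running_state p).1.

(* Value of the position after [p], the stock being valued at price [x]. *)
Definition wealth p x : R :=
  total_return p (running_state p).2 *
  (if (running_state p).1 is Some b then x / nth 0 p b else 1).

Lemma foldl_running_step_rcons p x st :
  foldl (running_step (rcons p x)) st (iota 0 (size p)) =
  foldl (running_step p) st (iota 0 (size p)).
Proof.
have : all (fun d => (d < size p)%N) (iota 0 (size p)).
  by apply/allP => d; rewrite mem_iota.
elim: (iota _ _) st => //= d s IH st /andP[hd hs].
by rewrite IH // /running_step -cats1 takel_cat.
Qed.

Lemma running_state_rcons p x :
  running_state (rcons p x) =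
  running_step (rcons p x) (running_state p) (size p).
Proof.
rewrite {1}/running_state size_rcons -addn1 iotaD foldl_cat /=.
by rewrite foldl_running_step_rcons.
Qed.

Lemma foldl_day_step_rcons p x st :
  foldl (day_step k A (rcons p x)) st (iota 0 (size p)) =
  foldl (running_step p) st (iota 0 (size p)).
Proof.
have : all (fun d => (d < size p)%N) (iota 0 (size p)).
  by apply/allP => d; rewrite mem_iota.
elim: (iota _ _) st => //= d s IH st /andP[hd hs].
rewrite IH // /running_step /day_step size_rcons eqSS ltn_eqF //=.
by rewrite -cats1 takel_cat.
Qed.

Lemma running_state_in_range p :
  all (fun t : trade => (t.1 < size p)%N && (t.2 < size p)%N)
    (running_state p).2 /\
  (if (running_state p).1 is Some b then (b < size p)%N else true).
Proof.
elim/last_ind: p => [//|p x [al hb]].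
have al' : all (fun t : trade => (t.1 < size (rcons p x))%N
    && (t.2 < size (rcons p x))%N) (running_state p).2.
  by apply: sub_all al => t; rewrite size_rcons; lia.
rewrite running_state_rcons.
move: al' hb; case: (running_state p) => -[b|] l /= al' hb.
  case: ifP => _ /=; rewrite ?all_rcons ?al' size_rcons ?andbT;
    split=> //=; lia.
by case: ifP => _ /=; rewrite ?al' ?size_rcons.
Qed.

(** Buying or selling at price [x] exchanges equal values when the stock is valued at [x]. *)
Lemma wealth_rcons p x : 0 < x -> wealth (rcons p x) x = wealth p x.
Proof.
move=> x0; have [al hb] := running_state_in_range p.
rewrite /wealth running_state_rcons.
move: al hb; case: (running_state p) => -[b|] l /= al hb.
  case: ifP => _ /=.
    rewrite total_return_rcons -cats1 total_return_cat // mulr1 /gain /=.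
    by rewrite !nth_cat hb ltnn subnn.
  by rewrite -cats1 total_return_cat // nth_cat hb.
case: ifP => _ /=; rewrite -cats1 total_return_cat //.
by rewrite nth_cat ltnn subnn /= divff // gt_eqF.
Qed.

Lemma wealth_idle p x y : ~~ holding p -> wealth p x = wealth p y.
Proof. by rewrite /holding /wealth; case: (running_state p).1. Qed.

Lemma wealth_holding p x y : 0 < y -> holding p ->
  wealth p x = wealth p y * (x / y).
Proof.
rewrite /holding /wealth; case: (running_state p).1 => // b y0 _.
by rewrite -mulrA; congr (_ * _); rewrite [RHS]mulrC mulrA divfK ?gt_eqF.
Qed.

Lemma wealth_gt0 p x : (forall y, y \in p -> 0 < y) -> 0 < x -> 0 < wealth p x.
Proof.
move=> hp x0; have [/allP al hb] := running_state_in_range p.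
rewrite /wealth; apply: mulr_gt0.
  rewrite /total_return big_seq; apply: prodr_gt0 => t /al /andP[h1 h2].
  by rewrite divr_gt0 // hp // mem_nth.
move: hb; case: (running_state p).1 => // b hb.
by rewrite divr_gt0 // hp // mem_nth.
Qed.

(** On the last day nothing can be bought and held stock is sold at [x], whatever [A] answers. *)
Lemma total_return_trades_of_rcons p x :
  total_return (rcons p x) (trades_of k A (rcons p x)) = wealth p x.
Proof.
have [al hb] := running_state_in_range p.
rewrite /trades_of size_rcons -addn1 iotaD foldl_cat foldl_day_step_rcons /=.
rewrite -/(running_state p) /wealth.
move: al hb; case: (running_state p) => -[b|] l /= al hb;
  rewrite size_rcons add0n eqxx /=.
  rewrite total_return_rcons -cats1 total_return_cat // /gain /=.
  by rewrite !nth_cat hb ltnn subnn.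
by rewrite -cats1 total_return_cat // mulr1.
Qed.

End OnlineRun.

(** * The adversary's strategy and its invariants *)

Section Adversary.
Variables (R : realType) (k : nat) (A : online_algorithm R).
Variables (m M g : R) (n : nat).
Hypotheses (m_gt0 : 0 < m) (g_gt1 : 1 < g) (n_gt0 : (0 < n)%N).
Hypothesis ME : M = m * g ^+ (3 * n).
Implicit Types (p : seq R) (i : nat).

Local Notation wealth := (wealth k A).
Local Notation holding := (holding k A).

Let b := (2 * n).-1.

Definition in_range p := forall x, x \in p -> m <= x <= M.

(* The online player's wealth is valued at [M], so this also covers a player
   who has just bought at [M]. *)
Definition restart i p :=
  in_range p /\ reach p i (wealth p M * g ^+ (b * i)).

(** Since [b * i + (3 * n).-1 = b * i.+1 + n], the leads exceed the required ones by [g ^+ n.-1]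
    with [i] trades and by [g ^+ n] with [i.+1]. *)
Definition trapped i p :=
  [/\ in_range p, holding p, reach p i (wealth p m * g ^+ (b * i + n.-1))
    & reach p i.+1 (wealth p m * g ^+ (b * i + (3 * n).-1))].

Definition adversary_wins :=
  exists p x, [/\ in_range (rcons p x), m <= x &
    reach (rcons p x) k (wealth p x * g ^+ (b * k.-1 + (3 * n).-1))].

Local Ltac exponent_lia :=
  repeat match goal with H : is_true (_ < 3 * n)%N |- _ => revert H end;
  clear -n_gt0 b; rewrite ?mulnS;
  repeat match goal with |- context [(b * ?j)%N] =>
    generalize (b * j)%N; intro end; rewrite /b; lia.

Let g_gt0 : 0 < g := lt_trans ltr01 g_gt1.

Let price_gt0 e : 0 < m * g ^+ e.
Proof. by rewrite mulr_gt0 // exprn_gt0. Qed.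

Let price_div_m e : m * g ^+ e / m = g ^+ e.
Proof. by rewrite mulrAC divff ?mul1r // gt_eqF. Qed.

Let price_in_range e : (e <= 3 * n)%N -> m <= m * g ^+ e <= M.
Proof.
move=> he; rewrite ME ler_pM2l // ler_weXn2l ?(ltW g_gt1) // andbT.
by rewrite ler_peMr ?(ltW m_gt0) // exprn_ege1 // ltW.
Qed.

Let M_in_range : m <= M <= M.
Proof. by rewrite {1 2}ME price_in_range. Qed.

Let m_in_range : m <= m <= M.
Proof. by rewrite lexx; case/andP: M_in_range. Qed.

Let M_gt0 : 0 < M.
Proof. by rewrite ME. Qed.

Lemma in_range_rcons p x : in_range p -> m <= x <= M -> in_range (rcons p x).
Proof. by move=> hp hx y; rewrite mem_rcons inE => /orP[/eqP->|/hp]. Qed.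

Lemma wealth_ge0 p x : in_range p -> 0 < x -> 0 <= wealth p x.
Proof.
move=> hp x0; apply/ltW/wealth_gt0 => // y /hp /andP[my _].
exact: lt_le_trans my.
Qed.

Lemma wealth_holding_expr p e : holding p ->
  wealth p (m * g ^+ e) = wealth p m * g ^+ e.
Proof. by move=> hp; rewrite (wealth_holding _ m_gt0 hp) price_div_m. Qed.

Lemma ler_wealth_expr p x e e' : in_range p -> 0 < x -> (e <= e')%N ->
  wealth p x * g ^+ e <= wealth p x * g ^+ e'.
Proof.
move=> hp x0 he; rewrite ler_wpM2l ?wealth_ge0 // ler_weXn2l //.
exact: ltW.
Qed.

(** Valuing held stock at [m] instead of [M] lowers the online wealth by [g ^+ (3 * n)]. *)
Lemma restart_holding i p : restart i p -> holding p -> trapped i p.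
Proof.
move=> [hp ri] hold.
have wE : wealth p M * g ^+ (b * i) = wealth p m * g ^+ (b * i + 3 * n).
  by rewrite ME wealth_holding_expr // -mulrA -exprD addnC.
rewrite wE in ri; split=> //.
  by apply: reach_le ri; apply: ler_wealth_expr => //; exponent_lia.
by apply/reachS; apply: reach_le ri; apply: ler_wealth_expr => //; exponent_lia.
Qed.

(** Induction on the number [T] of grid levels shown, each followed by [M]. The first alternative is
    a purchase on the way, the second an idle player. *)
Lemma descent i p T : (T < 3 * n)%N -> restart i p -> ~~ holding p ->
  (exists q, [/\ in_range q, holding q,
     reach q i (wealth q m * g ^+ (b * i + (3 * n - T)))
   & reach q i.+1 (wealth q m * g ^+ (b * i + (3 * n).-1))]) \/
  (exists q, [/\ in_range q, ~~ holding q,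
     reach q i (wealth q M * g ^+ (b * i))
   & reach q i.+1 (wealth q M * g ^+ (b * i + T))]).
Proof.
move=> hT [hp ri] idle; elim: T hT => [|T IH] hT.
  by right; exists p; rewrite addn0; split=> //; exact: reachS.
case: IH => [|[q [hq hold r1 r2]]|[q [hq id1 r1 r2]]]; first by exponent_lia.
  left; exists q; split=> //; apply: reach_le r1; apply: ler_wealth_expr => //.
  by exponent_lia.
pose x := m * g ^+ (3 * n - T.+1).
have xr : m <= x <= M by apply: price_in_range; exponent_lia.
have x0 : 0 < x by exact: price_gt0.
pose q1 := rcons q x.
have hq1 : in_range q1 by exact: in_range_rcons.
have w1 : wealth q1 x = wealth q M.
  by rewrite wealth_rcons // (@wealth_idle _ _ _ _ _ M).
have [hold1|id2] := boolP (holding q1).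
  left; exists q1.
  have wm : wealth q M = wealth q1 m * g ^+ (3 * n - T.+1).
    by rewrite -w1 wealth_holding_expr.
  split=> //.
    apply: reach_rcons; apply: reach_le r1.
    by rewrite wm -mulrA -exprD addnC.
  (* The previous rise won [g ^+ T], and devaluing the stock from [x] to [m] adds
     [g ^+ (3 * n - T.+1)]: together one grid step less than [g ^+ (3 * n)]. *)
  apply: reach_rcons; apply: reach_le r2.
  rewrite wm -mulrA -exprD; apply: ler_wealth_expr => //; exponent_lia.
pose q2 := rcons q1 M.
have hq2 : in_range q2 by exact: in_range_rcons.
have w2 : wealth q2 M = wealth q M.
  by rewrite wealth_rcons // (@wealth_idle _ _ _ _ _ x).
have r1' : reach q2 i (wealth q2 M * g ^+ (b * i)).
  by rewrite w2; do 2!apply: reach_rcons.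
have [hold2|id3] := boolP (holding q2).
  have [_ _ _ r2'] := @restart_holding i q2 (conj hq2 r1') hold2.
  left; exists q2; split=> //.
  apply: reach_le r1'.
  rewrite [X in _ <= wealth _ X * _]ME wealth_holding_expr //.
  by rewrite -mulrA -exprD; apply: ler_wealth_expr => //; exponent_lia.
right; exists q2; split=> //.
have := @reach_trade _ q [::] i _ x M x0 M_gt0 r1.
rewrite /= -cat_rcons cats1 w2; apply: reach_le.
rewrite -mulrA ler_wpM2l ?wealth_ge0 // exprD.
rewrite ler_wpM2l ?exprn_ge0 ?(ltW g_gt0) //.
rewrite ler_pdivlMr // ME mulrCA ler_pM2l // -exprD ler_weXn2l ?(ltW g_gt1) //.
by exponent_lia.
Qed.

Lemma wins_last_trade p i : i.+1 = k -> in_range p ->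
  reach p i.+1 (wealth p m * g ^+ (b * i + (3 * n).-1)) -> adversary_wins.
Proof.
move=> ik hp r; exists p, m; split=> //; first exact: in_range_rcons.
have -> : k.-1 = i by rewrite -ik.
by apply: reach_rcons; move: r; rewrite ik.
Qed.

Lemma restart_step i p : (i.+1 < k)%N -> restart i p ->
  (exists q, restart i.+1 q) \/ (exists q, trapped i q).
Proof.
move=> ik rp; have [hold|idle] := boolP (holding p).
  by right; exists p; exact: restart_holding.
(* Depth [b]: an idle player concedes exactly [g ^+ b], while a buyer paid at least
   [m * g ^+ n.+1]. *)
have := @descent i p (2 * n).-1 _ rp idle.
case=> [|[q [hq hold r1 r2]]|[q [hq id1 r1 r2]]]; first by exponent_lia.
  right; exists q; split=> //; apply: reach_le r1; apply: ler_wealth_expr => //.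
  by exponent_lia.
left; exists q; split=> //; apply: reach_le r2; apply: ler_wealth_expr => //.
by exponent_lia.
Qed.

Lemma restart_last i p : i.+1 = k -> restart i p -> adversary_wins.
Proof.
move=> ik rp; have [hold|idle] := boolP (holding p).
  have [hp _ _] := restart_holding rp hold.
  exact: wins_last_trade.
have := @descent i p (3 * n).-1 _ rp idle.
case=> [|[q [hq hold _]]|[q [hq id1 _]]]; first by exponent_lia.
  exact: wins_last_trade.
rewrite (@wealth_idle _ _ _ _ _ m) //; exact: wins_last_trade.
Qed.

Lemma trapped_step i p : (i.+1 < k)%N -> trapped i p ->
  (exists q, restart i.+1 q) \/ (exists q, trapped i.+1 q).
Proof.
move=> ik [hp hold r1 r2].
pose q1 := rcons p m; have hq1 : in_range q1 by exact: in_range_rcons.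
have w1 : wealth q1 m = wealth p m by exact: wealth_rcons.
have [hold1|id1] := boolP (holding q1); last first.
  (* Sold at [m]: the lead with [i.+1] trades already suffices. *)
  left; exists q1; split=> //; apply: reach_rcons; apply: reach_le r2.
  rewrite (@wealth_idle _ _ _ _ _ m) // w1.
  by apply: ler_wealth_expr => //; exponent_lia.
pose y := m * g ^+ (2 * n).-1; have y0 : 0 < y by exact: price_gt0.
pose q2 := rcons q1 y.
have hq2 : in_range q2.
  by apply: in_range_rcons => //; apply: price_in_range; exponent_lia.
have w2 : wealth q2 y = wealth p m * g ^+ (2 * n).-1.
  by rewrite wealth_rcons // wealth_holding_expr // w1.
have [hold2|id2] := boolP (holding q2).
  right; exists q2.
  have wE : wealth q2 m = wealth p m.
    apply: (@mulIf _ (g ^+ (2 * n).-1)); first by rewrite gt_eqF // exprn_gt0.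
    by rewrite -w2 wealth_holding_expr.
  split=> //; rewrite wE.
    do 2!apply: reach_rcons; apply: reach_le r2; apply: ler_wealth_expr => //.
    by exponent_lia.
  (* Stock kept: the rise from [m] to [y] adds a trade worth [g ^+ b], while the wealth valued at
     [m] is unchanged. *)
  have := @reach_trade _ p [::] i.+1 _ m y m_gt0 y0 r2.
  rewrite /= -cat_rcons cats1; apply: reach_le.
  rewrite /y price_div_m -mulrA -exprD.
  by apply: ler_wealth_expr => //; exponent_lia.
left; pose q3 := rcons q2 M.
have hq3 : in_range q3 by exact: in_range_rcons.
exists q3; split=> //.
(* Sold at [y]: one trade from [m] to [M] gains [n.+1] grid steps on the online player, and the
   spare [n.-1] bring this to [2 * n], above [b]. *)
have := @reach_trade _ p [:: y] i _ m M m_gt0 M_gt0 r1.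
rewrite /= -cat_rcons -cat_rcons cats1; apply: reach_le.
rewrite wealth_rcons // (@wealth_idle _ _ _ _ _ y) // w2.
rewrite [in X in _ <= X]ME price_div_m -mulrA -exprD -[X in _ <= X]mulrA -exprD.
by apply: ler_wealth_expr => //; exponent_lia.
Qed.

Lemma adversary_wins_from i p : (i < k)%N ->
  restart i p \/ trapped i p -> adversary_wins.
Proof.
move: {2}(k - i.+1)%N (leqnn (k - i.+1)) => d; elim: d i p => [|d IH] i p hd ik.
  have ik' : i.+1 = k by lia.
  case=> [|[hp _ _]]; first exact: restart_last.
  exact: wins_last_trade.
have [ik'|ik'] : i.+1 = k \/ (i.+1 < k)%N by lia.
  case=> [|[hp _ _]]; first exact: restart_last.
  exact: wins_last_trade.
have hd' : (k - i.+2 <= d)%N by lia.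
have next : forall q, restart i.+1 q \/ trapped i.+1 q -> adversary_wins.
  by move=> q; exact: IH.
(* Settled first, because [restart_step] may lead to [trapped] with the same [i]. *)
have from_trapped q : trapped i q -> adversary_wins.
  by move=> /(trapped_step ik')[[q' h]|[q' h]]; apply: (next q'); [left|right].
case=> [/(restart_step ik')[[q h]|[q /from_trapped]]|/from_trapped] //.
by apply: (next q); left.
Qed.

Lemma competitive_ratio_ge : (0 < k)%N ->
  ((g ^+ (b * k.-1 + (3 * n).-1))%:E <= competitive_ratio m M k A)%E.
Proof.
move=> k0.
have : adversary_wins.
  apply: (@adversary_wins_from 0 [::]) => //; left; split=> //.
  exists [::]; first by [].
  by rewrite /wealth /= muln0 expr0 /total_return big_nil !mulr1.
move=> [p [x [hp mx r]]].
have x0 : 0 < x by exact: lt_le_trans mx.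
have hp' : in_range p by move=> y hy; apply: hp; rewrite mem_rcons inE hy orbT.
have w0 : 0 < wealth p x.
  by apply: wealth_gt0 => // y /hp' /andP[my _]; exact: lt_le_trans my.
apply: (@le_trans _ _ (OPT k (rcons p x) /
    total_return (rcons p x) (trades_of k A (rcons p x)))%:E).
  rewrite lee_fin total_return_trades_of_rcons ler_pdivlMr // mulrC.
  apply: (@reach_le_OPT _ _ _ _ (M / m)) r.
    by rewrite ler_pdivlMr // mul1r; case/andP: M_in_range.
  move=> u v /hp /andP[mu _] /hp /andP[mv vM].
  have u0 := lt_le_trans m_gt0 mu; have v0 := lt_le_trans m_gt0 mv.
  rewrite divr_ge0 ?(ltW u0) ?(ltW v0) //=.
  by apply: ler_pM => //; rewrite ?(ltW v0) ?invr_ge0 ?(ltW u0) // lef_pV2.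
apply: ereal_sup_ubound; exists (rcons p x) => //; split=> //.
by rewrite size_rcons.
Qed.

End Adversary.

(** * Choice of the grid and the final exponent *)

Lemma final_exponent n k : (0 < n)%N -> (0 < k)%N ->
  ((2 * n).-1 * k.-1 + (3 * n).-1 + k = n * (2 * k + 1))%N.
Proof. by case: n k => [//|n] [//|k] _ _ /=; nia. Qed.

Theorem theorem3 (R : realType) (m M : R) (k : nat) (eps : R)
    (hm : 0 < m) (hmM : m < M) (hk : (1 <= k)%N) (heps : 0 < eps) :
  ~ exists A : online_algorithm R,
      (competitive_ratio m M k A <
         ((M / m) `^ ((2 * k + 1)%:R / 3 - eps))%:E)%E.
Proof.
move=> [A]; apply/negP; rewrite -leNgt.
(* The grid costs [k] steps in all, a factor [phi] to the power [k / (3 * n)], which must stay below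
   [phi] to the power [eps]. *)
have [n n_gt0 kn] : exists2 n : nat, (0 < n)%N & k%:R < n%:R * eps.
  exists (Num.truncn (k%:R / eps)).+1 => //.
  by rewrite -ltr_pdivrMr // truncnS_gt.
have phi1 : 1 < M / m by rewrite ltr_pdivlMr // mul1r.
have n0 : (0 : R) < (3 * n)%:R by rewrite ltr0n muln_gt0.
pose g := (M / m) `^ (3 * n)%:R^-1.
have phiE : g ^+ (3 * n) = M / m.
  rewrite -powR_mulrn ?powR_ge0 // -powRrM mulVf ?gt_eqF // powRr1 //.
  by rewrite ltW // (lt_trans ltr01).
have g1 : 1 < g.
  rewrite ltNge; apply/negP => g1; move: phi1; rewrite -phiE ltNge.
  by rewrite exprn_ile1 // powR_ge0.
have ME : M = m * g ^+ (3 * n) by rewrite phiE mulrC divfK // gt_eqF.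
have := @competitive_ratio_ge R k A m M g n hm g1 n_gt0 ME hk.
apply: le_trans.
rewrite lee_fin -phiE -powR_mulrn ?powR_ge0 // -powRrM -powR_mulrn ?powR_ge0 //.
apply: ler_powR; first exact: ltW.
(* Exponents of [g] are compared; adding [k] to both sides avoids truncated subtraction. *)
move: kn; rewrite [(3 * n)%:R]natrM -(lerD2r k%:R) -[X in _ <= X]natrD.
rewrite final_exponent //.
rewrite [(n * _)%:R]natrM; move: (2 * k + 1)%N%:R => u.
have : 0 <= n%:R * eps by rewrite mulr_ge0 ?ler0n ?ltW.
lra.
Qed.
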